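(* Let $(\mathfrak{A},\mathsf{L})$ be a Lipschitz pair. The topology induced by the extended Monge-Kantorovich metric $\mathsf{mk}_{\mathsf{L}}$ on the state space $\mathscr{S}(\mathfrak{A})$ of $\mathfrak{A}$ is finer than the weak* topology.
   Context: For a C*-algebra $\mathfrak{A}$: $\mathfrak{u}\mathfrak{A}$ is $\mathfrak{A}$ if $\mathfrak{A}$ is unital and its standard unitization $\mathfrak{A}\oplus\mathbb{C}$ otherwise, with unit $1$; $\mathfrak{sa}(\cdot)$ denotes self-adjoint elements; $\mathscr{S}(\mathfrak{A})$ is the state space; each state is identified with its unique extension to a state of $\mathfrak{u}\mathfrak{A}$. The weak* topology is $\sigma(\mathfrak{A}^\ast,\mathfrak{A})$ restricted to $\mathscr{S}(\mathfrak{A})$. A Lipschitz pair $(\mathfrak{A},\mathsf{L})$ is a C*-algebra $\mathfrak{A}$ with a seminorm $\mathsf{L}$ defined on a dense subspace of $\mathfrak{sa}(\mathfrak{u}\mathfrak{A})$ such that $\{a\in\mathfrak{sa}(\mathfrak{u}\mathfrak{A}):\mathsf{L}(a)=0\}=\mathbb{R}1$ (writing $\mathsf{L}(a)\leq 1$ presumes $a$ is in the domain). The extended Monge-Kantorovich metric is $\mathsf{mk}_{\mathsf{L}}(\varphi,\psi)=\sup\{|\varphi(a)-\psi(a)|:a\in\mathfrak{sa}(\mathfrak{A}),\ \mathsf{L}(a)\leq1\}\in[0,\infty]$ for $\varphi,\psi\in\mathscr{S}(\mathfrak{A})$; ''finer'' is not necessarily strict. *)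

(* Defs.v *)
From HB Require Import structures.
From mathcomp Require Import all_boot all_order all_algebra.
From mathcomp Require Import complex.
From mathcomp Require Import all_classical all_reals all_analysis.

Set Implicit Arguments.
Unset Strict Implicit.
Unset Printing Implicit Defensive.

Import Order.TTheory GRing.Theory Num.Theory.
Import numFieldNormedType.Exports.

Local Open Scope classical_set_scope.
Local Open Scope ring_scope.
Local Open Scope complex_scope.

(* C*-algebras, not assumed to have a unit.  As MathComp has no structure of
   non-unital associative algebra, the product is part of the mixin. *)
HB.mixin Record CompleteNormedModule_isCStarAlgebra (R : realType) A
    of CompleteNormedModule R[i] A := {
  cmul : A -> A -> A ;
  cstar : A -> A ;
  cmulA : associative cmul ;
  cmulDl : left_distributive cmul +%R ;
  cmulDr : right_distributive cmul +%R ;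
  cmulZl : forall (k : R[i]) (a b : A), cmul (k *: a) b = k *: cmul a b ;
  cmulZr : forall (k : R[i]) (a b : A), cmul a (k *: b) = k *: cmul a b ;
  cstarK : involutive cstar ;
  cstarD : {morph cstar : a b / a + b} ;
  cstarZ : forall (k : R[i]) (a : A), cstar (k *: a) = k^* *: cstar a ;
  cstarM : forall a b : A, cstar (cmul a b) = cmul (cstar b) (cstar a) ;
  cnormM : forall a b : A, `|cmul a b| <= `|a| * `|b| ;
  cnorm_star : forall a : A, `|cmul (cstar a) a| = `|a| ^+ 2
}.

#[short(type="cstarAlgType")]
HB.structure Definition CStarAlgebra (R : realType) :=
  {A of CompleteNormedModule R[i] A & CompleteNormedModule_isCStarAlgebra R A}.

(* Norms of R[i]-normed spaces take (real, nonnegative) values in R[i]. *)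
Definition rnorm (R : realType) (V : normedZmodType R[i]) (v : V) : R :=
  complex.Re `|v|.

Definition sa (R : realType) (A : cstarAlgType R) : set A :=
  [set a | cstar a = a].

Section Unitization.
Variables (R : realType) (A : cstarAlgType R).

Definition is_unit_elt (e : A) := forall a : A, cmul e a = a /\ cmul a e = a.

Definition unital : Prop := exists e : A, is_unit_elt e.

(* uA is realized inside A (+) C, with A embedded by a |-> (a, 0): it is the
   copy A (+) 0 of A if A is unital, and the whole of A (+) C otherwise.
   The canonical (max) norm of the product type is not used; see unorm. *)
Definition unitization : set (A * R[i]) := [set x | unital -> x.2 = 0].

Definition uemb (a : A) : A * R[i] := (a, 0).

Definition umul (x y : A * R[i]) : A * R[i] :=
  (cmul x.1 y.1 + y.2 *: x.1 + x.2 *: y.1, x.2 * y.2).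

Definition ustar (x : A * R[i]) : A * R[i] := (cstar x.1, x.2^*).

Definition uone : A * R[i] :=
  if pselect unital is left ex_e then uemb (projT1 (cid ex_e)) else (0, 1).

(* The C*-norm of uA: the norm of x acting on A by left multiplication. *)
Definition unorm (x : A * R[i]) : R :=
  sup [set rnorm (umul x (uemb b)).1 | b in [set b : A | rnorm b <= 1]].

Definition usa : set (A * R[i]) := [set x | unitization x /\ ustar x = x].

End Unitization.

Arguments unitization {R} A.
Arguments uone {R} A.
Arguments usa {R} A.

Section UnitizationFacts.
Variables (R : realType) (A : cstarAlgType R).
Implicit Types (a b : A) (x : A * R[i]).

Lemma rnormE (V : normedZmodType R[i]) (v : V) : `|v| = (rnorm v)%:C.
Proof. by rewrite /rnorm RRe_real ?normr_real. Qed.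

Lemma rnorm_ge0 (V : normedZmodType R[i]) (v : V) : 0 <= rnorm v.
Proof. by rewrite -lecR -rnormE; exact: normr_ge0. Qed.

Lemma rnorm0 (V : normedZmodType R[i]) : rnorm (0 : V) = 0.
Proof. by rewrite /rnorm normr0. Qed.

Lemma rnormB (V : normedZmodType R[i]) (u v : V) : rnorm (u - v) = rnorm (v - u).
Proof. by rewrite /rnorm distrC. Qed.

Lemma ler_rnormD (V : normedZmodType R[i]) (u v : V) :
  rnorm (u + v) <= rnorm u + rnorm v.
Proof. by rewrite -lecR rmorphD /= -!rnormE ler_normD. Qed.

Lemma rnormM a b : rnorm (cmul a b) <= rnorm a * rnorm b.
Proof. by rewrite -lecR rmorphM /= -!rnormE cnormM. Qed.

Lemma rnormZr (t : R) a : rnorm (t%:C *: a) = `|t| * rnorm a.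
Proof.
have tC : `|t%:C| = `|t|%:C :> R[i] by rewrite normc_def /= expr0n addr0 sqrtr_sqr.
by apply/complexI; rewrite rmorphM /= -rnormE normrZ tC -rnormE.
Qed.

Lemma rnorm_cstar a : rnorm (cstar a) = rnorm a.
Proof.
have le_star b : rnorm b <= rnorm (cstar b).
  have : rnorm b ^+ 2 <= rnorm (cstar b) * rnorm b.
    by rewrite -lecR rmorphXn rmorphM /= -!rnormE -cnorm_star cnormM.
  have := rnorm_ge0 b; rewrite le_eqVlt => /predU1P[<- _|b0].
    exact: rnorm_ge0.
  by rewrite expr2 ler_pM2r.
by apply/le_anti; rewrite [X in _ && X]le_star andbT -{2}(cstarK a) le_star.
Qed.

Lemma uone_unit x : unitization A x -> umul (uone A) x = x /\ umul x (uone A) = x.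
Proof.
case: x => a k; rewrite /unitization /uone /umul /=.
case: pselect => [ex_e /(_ ex_e) ->|nu _] /=; last first.
  have c0l b : cmul (0 : A) b = 0 by rewrite -(scale0r 0) cmulZl !scale0r.
  have c0r b : cmul b (0 : A) = 0 by rewrite -(scale0r 0) cmulZr !scale0r.
  by rewrite c0l c0r !scaler0 !scale1r mul1r mulr1 !(add0r, addr0).
case: cid => e /= /(_ a)[-> ->].
by rewrite !scale0r !addr0 mulr0.
Qed.

Lemma unorm_uemb a : unorm (uemb a) = rnorm a.
Proof.
have actE b : (umul (uemb a) (uemb b)).1 = cmul a b.
  by rewrite /umul /= !scale0r !addr0.
have le_act b : rnorm b <= 1 -> rnorm (cmul a b) <= rnorm a.
  by move=> b1; rewrite (le_trans (rnormM _ _))// ler_piMr// rnorm_ge0.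
apply/le_anti/andP; split.
  apply: ge_sup; first by exists (rnorm (umul (uemb a) (uemb 0)).1), 0; rewrite //= rnorm0.
  by move=> _ [b b1 <-]; rewrite actE; exact: le_act.
have act_le b : rnorm b <= 1 -> rnorm (cmul a b) <= unorm (uemb a).
  move=> b1; apply: ub_le_sup; last by exists b => //; rewrite actE.
  by exists (rnorm a) => _ [c c1 <-]; rewrite actE; exact: le_act.
have [a0|an0] := eqVneq (rnorm a) 0.
  by rewrite a0 (le_trans _ (act_le 0 _)) ?rnorm_ge0 ?rnorm0.
have a0 : 0 < rnorm a by rewrite lt_neqAle eq_sym an0 rnorm_ge0.
have aV : 0 <= (rnorm a)^-1 by rewrite invr_ge0 ltW.
have := act_le ((rnorm a)^-1%:C *: cstar a).
rewrite cmulZr !rnormZr rnorm_cstar (ger0_norm aV).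
have -> : rnorm (cmul a (cstar a)) = rnorm a ^+ 2.
  apply/complexI; rewrite rmorphXn /= -rnormE -{1}(cstarK a) cnorm_star.
  by rewrite rnormE rnorm_cstar.
by rewrite expr2 mulKf// mulVf//; exact.
Qed.

End UnitizationFacts.

Record state (R : realType) (A : cstarAlgType R) := State {
  state_fun :> {scalar A} ;
  state_pos : forall a : A, 0 <= state_fun (cmul (cstar a) a) ;
  state_norm : ereal_sup
    [set (rnorm (state_fun a))%:E | a in [set a : A | rnorm a <= 1]] = 1%E
}.

HB.instance Definition _ (R : realType) (A : cstarAlgType R) :=
  gen_eqMixin (state A).
HB.instance Definition _ (R : realType) (A : cstarAlgType R) :=
  gen_choiceMixin (state A).

(* A seminorm defined on a dense real subspace ldom of sa(uA); the values of lip
   outside ldom are irrelevant. *)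
Record lipschitz_seminorm (R : realType) (A : cstarAlgType R) := LipSeminorm {
  ldom : set (A * R[i]) ;
  lip :> A * R[i] -> R ;
  ldom_sub : ldom `<=` usa A ;
  ldom0 : ldom 0 ;
  ldomD : forall x y, ldom x -> ldom y -> ldom (x + y) ;
  ldomZ : forall (t : R) x, ldom x -> ldom (t%:C *: x) ;
  ldom_dense : forall x, usa A x -> forall e : R, 0 < e ->
    exists2 y, ldom y & unorm (x - y) < e ;
  lip_ge0 : forall x, ldom x -> 0 <= lip x ;
  lipD : forall x y, ldom x -> ldom y -> lip (x + y) <= lip x + lip y ;
  lipZ : forall (t : R) x, ldom x -> lip (t%:C *: x) = `|t| * lip x ;
  lip_ker : [set x | ldom x /\ lip x = 0] = [set t%:C *: uone A | t in @setT R]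
}.

Definition mk (R : realType) (A : cstarAlgType R) (L : lipschitz_seminorm A)
    (phi psi : state A) : \bar R :=
  ereal_sup [set (rnorm (phi a - psi a))%:E | a in
    [set a : A | sa a /\ ldom L (uemb a) /\ L (uemb a) <= 1]].

(* sigma(A^*, A) restricted to states is pointwise convergence on A. *)
Definition weak_star_state (R : realType) (A : cstarAlgType R) : Type :=
  initial_topology (fun phi : state A => (phi : A -> R[i]^o) : {ptws A -> R[i]^o}).

HB.instance Definition _ (R : realType) (A : cstarAlgType R) :=
  Topological.on (weak_star_state A).

(* The state space with the topology of mk L.  A pseudoMetricType is given by its
   balls of finite radius, so infinite distances are allowed. *)
Definition mk_state (R : realType) (A : cstarAlgType R)
  (L : lipschitz_seminorm A) : Type := state A.

Section MongeKantorovichTopology.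
Variables (R : realType) (A : cstarAlgType R) (L : lipschitz_seminorm A).

HB.instance Definition _ := Choice.copy (mk_state L) (state A).

Let ball (phi : mk_state L) (e : R) : set (mk_state L) :=
  [set psi | (mk L phi psi < e%:E)%E].

Let ent : set_system (mk_state L * mk_state L) := entourage_ ball.

Let nbhs (phi : mk_state L) : set_system (mk_state L) := nbhs_ ent phi.

Let nbhsE : nbhs = nbhs_ ent. Proof. by []. Qed.

Let ball_center phi (e : R) : 0 < e -> ball phi e phi.
Proof.
move=> e0; rewrite /ball /=; apply: (@le_lt_trans _ _ 0%E); last by rewrite lte_fin.
by apply: ge_ereal_sup => _ [a _ <-]; rewrite subrr rnorm0.
Qed.

Let ball_sym phi psi (e : R) : ball phi e psi -> ball psi e phi.
Proof.
rewrite /ball /= => h; apply: le_lt_trans h.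
apply: ge_ereal_sup => _ [a La <-]; apply: ereal_sup_ubound.
by exists a => //; rewrite rnormB.
Qed.

Let ball_triangle phi psi chi (e1 e2 : R) :
  ball phi e1 psi -> ball psi e2 chi -> ball phi (e1 + e2) chi.
Proof.
rewrite /ball /= EFinD => h1 h2; apply: le_lt_trans (lteD h1 h2).
apply: ge_ereal_sup => _ [a La <-].
apply: (@le_trans _ _ ((rnorm (phi a - psi a))%:E + (rnorm (psi a - chi a))%:E)%E).
  by rewrite -EFinD lee_fin (le_trans _ (ler_rnormD _ _))// addrA subrK.
by apply: leeD; apply: ereal_sup_ubound; exists a.
Qed.

HB.instance Definition _ := hasNbhs.Build (mk_state L) nbhs.
HB.instance Definition _ := @Nbhs_isPseudoMetric.Build R (mk_state L)
  ent nbhsE ball ball_center ball_sym ball_triangle erefl.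

End MongeKantorovichTopology.

Definition weak_star_open (R : realType) (A : cstarAlgType R) :
  set_system (state A) := @open (weak_star_state A).

Definition mk_open (R : realType) (A : cstarAlgType R)
  (L : lipschitz_seminorm A) : set_system (state A) := @open (mk_state L).

Arguments weak_star_open {R} A.

(* Main.v *)
Require Import Defs.
From mathcomp Require Import all_boot all_order all_algebra.
From mathcomp Require Import all_classical all_reals all_analysis.
From mathcomp Require Import complex ring lra.

Set Implicit Arguments.
Unset Strict Implicit.
Unset Printing Implicit Defensive.

Import Order.TTheory GRing.Theory Num.Theory.
Import numFieldNormedType.Exports.

Local Open Scope classical_set_scope.
Local Open Scope ring_scope.
Local Open Scope complex_scope.

(** It suffices that evaluation at each element of A is continuous for mk_L,
since the weak* topology is the initial topology of these evaluations.

For s self-adjoint this is an epsilon/3 argument.  Choose b self-adjoint in A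
and in the domain of L with |s - b| < e/3 [ldom_dense_sa].  States are
contractive [state_le], so phi(s) and phi(b) differ by less than e/3 for every
state phi.  The element b / (L(b) + 1) is admissible in the supremum defining
mk_L, so |phi(b) - psi(b)| <= (L(b) + 1) mk_L(phi, psi) [mk_eval_le], which is
at most e/3 once psi is close enough to phi.  An arbitrary element is s + i t
with s and t self-adjoint, and the evaluations are linear.

The delicate point is the density of the domain in sa(A), because the
Lipschitz seminorm is only known to be densely defined in sa(uA), while mk_L
tests elements of A alone.  When A has no unit, an approximant of a has the
form b + t 1.  As 1 lies in the domain of L, so does b, and b is still close
to a provided that |t| is small.  This holds because the character
c + t 1 |-> t of uA is contractive [rnorm_scalar_le_unorm]: were |t| larger
than the norm of x = c + t 1, left multiplication by 1 - c' = x / t, where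
c' = - c / t belongs to A, would have norm r < 1 on A; the contraction
principle [contraction_fixpoint] would then solve c' e = c', and the solution
e would be a unit of A [unital_of_near_left_unit]. *)

(** * Real-valued norms on complex normed spaces *)

Lemma complex_gt0E (R : realType) (e : R[i]) : 0 < e ->
  exists2 r : R, 0 < r & e = r%:C.
Proof.
case: e => r s; rewrite ltcE /= => /andP[/eqP -> r0].
by exists r.
Qed.

Lemma conj_real (R : realType) (t : R) : Num.conj t%:C = t%:C.
Proof. exact: conjc_real. Qed.

Lemma rnorm_realM (R : realType) (t : R) (z : R[i]) :
  rnorm (t%:C * z) = `|t| * rnorm z.
Proof.
apply/complexI; rewrite rmorphM /= -!rnormE normrM; congr (_ * _).
by rewrite normc_def /= expr0n addr0 sqrtr_sqr.
Qed.

Section ComplexNormed.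
Variables (R : realType) (V : normedModType R[i]).

Lemma rnormZ (k : R[i]) (v : V) : rnorm (k *: v) = rnorm k * rnorm v.
Proof. by apply/complexI; rewrite rmorphM /= -!rnormE normrZ. Qed.

Lemma rnorm_eq0 (v : V) : rnorm v = 0 -> v = 0.
Proof. by move=> v0; apply/normr0_eq0; rewrite rnormE v0. Qed.

Lemma rnormN (v : V) : rnorm (- v) = rnorm v.
Proof. by rewrite /rnorm normrN. Qed.

Lemma rnorm_dist (w u v : V) : rnorm (u - v) <= rnorm (u - w) + rnorm (w - v).
Proof. by rewrite (le_trans _ (ler_rnormD _ _))// addrA subrK. Qed.

End ComplexNormed.

(** Banach's fixed point theorem over the complex scalars: the iterates d n of 0
stay in a ball of radius C, and d (n + m) and d n are the images of d m and 0
under the n-th iterate of T, so they are at distance at most r^n C. *)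
Lemma contraction_fixpoint (R : realType) (V : completeNormedModType R[i])
    (T : V -> V) (r : R) : 0 <= r -> r < 1 ->
  (forall u v, rnorm (T u - T v) <= r * rnorm (u - v)) ->
  exists v, T v = v.
Proof.
move=> r0 r1 Tr; pose d n := iter n T 0.
have r1' : 0 < 1 - r by rewrite subr_gt0.
pose C := rnorm (T 0) / (1 - r).
have C0 : 0 <= C by rewrite divr_ge0 ?rnorm_ge0 ?ltW.
have dC m : rnorm (d m) <= C.
  elim: m => [|m IH]; first by rewrite rnorm0.
  rewrite /d iterS -[X in rnorm X](subrK (T 0)) (le_trans (ler_rnormD _ _))//.
  have -> : C = r * C + rnorm (T 0).
    by rewrite /C; field; rewrite gt_eqF.
  by rewrite lerD2r (le_trans (Tr _ _))// subr0 ler_wpM2l.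
have dist n m : rnorm (d (n + m)%N - d n) <= r ^+ n * C.
  elim: n => [|n IH]; first by rewrite add0n subr0 expr0 mul1r.
  by rewrite exprS -mulrA (le_trans (Tr _ _))// ler_wpM2l.
have geo e : 0 < e -> \forall n \near \oo, r ^+ n * C < e.
  move=> e0; have : (fun n => r ^+ n * C) @ \oo --> (0 : R).
    rewrite -(mul0r C); apply: cvgM; last exact: cvg_cst.
    by apply: cvg_expr; rewrite ger0_norm.
  move/cvgrPdist_lt => /(_ _ e0); apply: filterS => n; rewrite sub0r normrN.
  exact/le_lt_trans/ler_norm.
have cd : cvgn d.
  apply/cauchy_cvgP; apply/cauchy_ballP => _ /complex_gt0E[e e0 ->].
  have e20 : 0 < e / 2 by rewrite divr_gt0.
  have [N _ NP] := geo _ e20.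
  near_simpl.
  exists ([set n | N <= n], [set n | N <= n])%N; first by split; exists N.
  move=> [n m] /= [Nn Nm]; rewrite -ball_normE /= rnormE ltcR.
  rewrite (le_lt_trans (rnorm_dist (d N) _ _))// [ltRHS](splitr e) ltrD//.
    by rewrite -(subnKC Nn) (le_lt_trans (dist _ _))//; apply: NP => /=.
  by rewrite rnormB -(subnKC Nm) (le_lt_trans (dist _ _))//; apply: NP => /=.
exists (limn d); apply/subr0_eq/rnorm_eq0/le_anti; rewrite rnorm_ge0 andbT.
apply/ler_addgt0Pl => e e0; rewrite addr0.
have e20 : 0 < e / 2 by rewrite divr_gt0.
have /cvgrPdist_lt/(_ (e / 2)%:C) : d @ \oo --> limn d by [].
rewrite ltcR => /(_ e20)[N _ NP].
have PN n : (N <= n)%N -> rnorm (limn d - d n) < e / 2.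
  by move=> /NP /=; rewrite rnormE ltcR.
rewrite (le_trans (rnorm_dist (d N.+1) _ _))// [leRHS](splitr e) lerD//; last first.
  by rewrite rnormB ltW// PN.
rewrite (le_trans (Tr _ _))// (le_trans _ (ltW (PN N (leqnn N))))//.
by rewrite ler_piMl ?rnorm_ge0// ltW.
Qed.

(** * The scalar part of the unitization *)

Section CStar.
Variables (R : realType) (A : cstarAlgType R).
Implicit Types (a b c : A) (x : A * R[i]).

Lemma cstarN a : cstar (- a) = - cstar a.
Proof. by rewrite -scaleN1r cstarZ rmorphN1 scaleN1r. Qed.

Lemma cmulBr a b c : cmul a (b - c) = cmul a b - cmul a c.
Proof. by rewrite cmulDr -scaleN1r cmulZr scaleN1r. Qed.

(** The hypothesis says that 1 - c has norm at most r < 1 as a left multiplication.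
Hence left multiplication by c is injective, and the affine contraction
u |-> c + (1 - c) u has a fixed point e, that is, c e = c.  Cancelling c in
c (e b) = c b shows that e is a left unit; its adjoint is a right unit, so the
two coincide. *)
Lemma unital_of_near_left_unit (c : A) (r : R) : 0 <= r -> r < 1 ->
  (forall b, rnorm (b - cmul c b) <= r * rnorm b) -> unital A.
Proof.
move=> r0 r1 cr.
have cancel b : cmul c b = 0 -> b = 0.
  move=> cb0; apply/rnorm_eq0/eqP; rewrite eq_le rnorm_ge0 andbT.
  have := cr b; rewrite cb0 subr0 -subr_le0 -{1}(mul1r (rnorm b)) -mulrBl.
  by rewrite pmulr_rle0// subr_gt0.
have [e eE] : exists e, c + (e - cmul c e) = e.
  apply: (contraction_fixpoint r0 r1) => u v.
  suff -> : c + (u - cmul c u) - (c + (v - cmul c v)) = (u - v) - cmul c (u - v).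
    exact: cr.
  by rewrite cmulBr opprD addrACA subrr add0r !opprB addrACA [RHS]addrACA [- v - _]addrC.
have ce : cmul c e = c.
  by move/eqP: eE; rewrite addrCA -subr_eq0 addrAC subrr add0r subr_eq0 => /eqP.
have el b : cmul e b = b.
  by apply/subr0_eq/cancel; rewrite cmulBr cmulA ce subrr.
have er b : cmul b (cstar e) = b by rewrite -{1}(cstarK b) -cstarM el cstarK.
have es : cstar e = e by rewrite -[LHS]el er.
by exists e => b; split; [exact: el | rewrite -{1}es er].
Qed.

Lemma rnorm_act_le_unorm x b :
  rnorm b <= 1 -> rnorm (cmul x.1 b + x.2 *: b) <= unorm x.
Proof.
have actE c : (umul x (uemb c)).1 = cmul x.1 c + x.2 *: c.
  by rewrite /umul /= scale0r addr0.
move=> b1; rewrite -actE; apply: ub_le_sup; last by exists b.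
exists (rnorm x.1 + rnorm x.2) => _ [d d1 <-]; rewrite actE.
rewrite (le_trans (ler_rnormD _ _))// rnormZ lerD//.
  by rewrite (le_trans (rnormM _ _))// ler_piMr// rnorm_ge0.
by rewrite ler_piMr// rnorm_ge0.
Qed.

Lemma unorm_ge0 x : 0 <= unorm x.
Proof. by rewrite (le_trans (rnorm_ge0 _) (@rnorm_act_le_unorm x 0 _))// rnorm0. Qed.

(** Homogeneity extends the bound from the unit ball to all of A. *)
Lemma rnorm_act_le x b : rnorm (cmul x.1 b + x.2 *: b) <= unorm x * rnorm b.
Proof.
have [/rnorm_eq0 ->|b0] := eqVneq (rnorm b) 0.
  by rewrite scaler0 addr0 -(scale0r (0 : A)) cmulZr !scale0r rnorm0 mulr0.
have {}b0 : 0 < rnorm b by rewrite lt_neqAle eq_sym b0 rnorm_ge0.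
have bV : `|(rnorm b)^-1| = (rnorm b)^-1 by rewrite ger0_norm// invr_ge0 ltW.
have := @rnorm_act_le_unorm x ((rnorm b)^-1%:C *: b).
rewrite cmulZr scalerA [x.2 * _]mulrC -scalerA -scalerDr !rnormZr bV.
rewrite mulVf ?gt_eqF// => /(_ (lexx _)).
by rewrite mulrC ler_pdivrMr.
Qed.

(** The quotient character of a genuine unitization is contractive.  Otherwise
x / x.2 = 1 - c, with c in A, is a strict contraction of A, which forces A to
be unital. *)
Lemma rnorm_scalar_le_unorm x : ~ unital A -> rnorm x.2 <= unorm x.
Proof.
move=> nu; rewrite leNgt; apply/negP => lt; apply: nu.
have u0 := unorm_ge0 x.
have t0 : 0 < rnorm x.2 by exact: le_lt_trans lt.
have x20 : x.2 != 0 by apply: contraTneq t0 => ->; rewrite rnorm0 ltxx.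
apply: (@unital_of_near_left_unit (- x.2^-1 *: x.1) (unorm x / rnorm x.2)).
- by rewrite divr_ge0// ltW.
- by rewrite ltr_pdivrMr// mul1r.
move=> b.
have -> : b - cmul (- x.2^-1 *: x.1) b = x.2^-1 *: (cmul x.1 b + x.2 *: b).
  by rewrite cmulZl scaleNr opprK scalerDr scalerA mulVf// scale1r addrC.
have tV : rnorm x.2^-1 = (rnorm x.2)^-1.
  by apply/complexI; rewrite fmorphV /= -!rnormE normfV.
by rewrite rnormZ tV mulrC -mulrA [_^-1 * _]mulrC mulrA ler_pM2r ?invr_gt0// rnorm_act_le.
Qed.

Lemma rnorm_fst_le x : rnorm x.1 <= unorm x + rnorm x.2.
Proof.
rewrite -unorm_uemb; apply: ge_sup.
  by exists (rnorm (umul (uemb x.1) (uemb 0)).1), 0; rewrite //= rnorm0.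
move=> _ [b /= b1 <-]; rewrite /umul /= !scale0r !addr0.
rewrite -[X in rnorm X](addrK (x.2 *: b)) (le_trans (ler_rnormD _ _))//.
rewrite rnormN rnormZ lerD// ?ler_piMr ?rnorm_ge0//.
exact: rnorm_act_le_unorm.
Qed.

(** In the non-unital case the approximant b + t 1 provided by density in sa(uA)
is corrected by subtracting t 1, which stays in the domain because the kernel
of L is R 1; the scalar t and the error this causes are bounded by the norm
of a - (b + t 1), whence the initial choice of e / 2. *)
Lemma ldom_dense_sa (L : lipschitz_seminorm A) a (e : R) : sa a -> 0 < e ->
  exists b, [/\ sa b, ldom L (uemb b) & rnorm (a - b) < e].
Proof.
move=> sa_a e0; have e20 : 0 < e / 2 by rewrite divr_gt0.
have usa_a : usa A (uemb a).
  split; first by move=> _.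
  by rewrite /ustar /uemb /= sa_a oppr0.
have [[b t] Ly ay] := ldom_dense L usa_a e20.
have [yu] := ldom_sub Ly; rewrite /ustar /= => -[sb st].
have [t' tE] : exists t' : R, t = t'%:C.
  exists (complex.Re t); case: t st {Ly ay yu} => u v /= [vE].
  by congr (_ +i* _); lra.
exists b; split=> //.
  have [u|nu] := pselect (unital A).
    by move: Ly; rewrite (_ : t = 0)//; exact: (yu u).
  have : ldom L ((b, t) + (- t')%:C *: uone A).
    apply: ldomD => //; apply: ldomZ.
    have : [set s%:C *: uone A | s in @setT R] (uone A) by exists 1; rewrite ?scale1r.
    by rewrite -(lip_ker L) => -[].
  rewrite /uone; case: pselect => // _.
  congr (ldom L _); rewrite /uemb tE; congr (_, _) => /=.
    by rewrite scaler0 addr0.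
  by rewrite rmorphN /= scaleNr /GRing.scale /= mulr1 subrr.
have [u|nu] := pselect (unital A).
  move: ay; rewrite (_ : uemb a - (b, t) = uemb (a - b)) ?unorm_uemb.
    by move/lt_trans; apply; rewrite ltr_pdivrMr// ltr_pMr// ltrDl.
  by rewrite (yu u : t = 0) /uemb; congr (_, _); rewrite /= subr0.
have := rnorm_fst_le (uemb a - (b, t)); move/le_lt_trans; apply.
rewrite [ltRHS]splitr ltrD//.
by rewrite (le_lt_trans (rnorm_scalar_le_unorm _ nu)).
Qed.

(** * Evaluations are continuous for the Monge-Kantorovich metric *)

Lemma state_le (phi : state A) a : rnorm (phi a) <= rnorm a.
Proof.
have [/rnorm_eq0 ->|a0] := eqVneq (rnorm a) 0; first by rewrite linear0 !rnorm0.
have {}a0 : 0 < rnorm a by rewrite lt_neqAle eq_sym a0 rnorm_ge0.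
have aV : `|(rnorm a)^-1| = (rnorm a)^-1 by rewrite ger0_norm// invr_ge0 ltW.
have : ((rnorm (phi ((rnorm a)^-1%:C *: a)))%:E <= 1%E)%E.
  rewrite -(state_norm phi); apply: ereal_sup_ubound; exists ((rnorm a)^-1%:C *: a) => //=.
  by rewrite rnormZr aV mulVf ?gt_eqF.
rewrite linearZ /= lee_fin rnorm_realM aV.
by rewrite mulrC ler_pdivrMr// mul1r.
Qed.

Section MK.
Variable L : lipschitz_seminorm A.

(** The scaling factor is L(b) + 1 rather than L(b), as L(b) vanishes when b is a
multiple of the unit. *)
Lemma mk_eval_le (phi psi : state A) b (d : R) : sa b -> ldom L (uemb b) ->
  (mk L phi psi < d%:E)%E -> rnorm (phi b - psi b) <= (lip L (uemb b) + 1) * d.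
Proof.
move=> sb Lb lt; set K := _ + 1.
have K0 : 0 < K by rewrite ltr_wpDl// lip_ge0.
have KV : `|K^-1| = K^-1 by rewrite ger0_norm// invr_ge0 ltW.
have embZ : uemb (K^-1%:C *: b) = K^-1%:C *: uemb b.
  by rewrite /uemb; congr (_, _); rewrite /= scaler0.
have : ((rnorm (phi (K^-1%:C *: b) - psi (K^-1%:C *: b)))%:E <= mk L phi psi)%E.
  apply: ereal_sup_ubound; exists (K^-1%:C *: b) => //=; split.
    by rewrite /sa /= cstarZ sb conj_real.
  rewrite embZ; split; first exact: ldomZ.
  by rewrite lipZ// KV mulrC ler_pdivrMr// mul1r lerDl.
move/le_lt_trans => /(_ _ lt).
have phiZ (chi : state A) : chi (K^-1%:C *: b) = K^-1%:C * chi b by rewrite linearZ.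
rewrite !phiZ lte_fin -mulrBr rnorm_realM KV.
by rewrite mulrC ltr_pdivrMr// mulrC => /ltW.
Qed.

Lemma eval_sa_continuous a : sa a ->
  continuous (fun psi : mk_state L => (psi : state A) a : R[i]^o).
Proof.
move=> sa_a phi; have phi_filter := @nbhs_filter (mk_state L) phi.
apply/cvgrPdist_lt => _ /complex_gt0E[e e0 ->].
have e30 : 0 < e / 3 by rewrite divr_gt0.
have [b [sb Lb ab]] := ldom_dense_sa L sa_a e30.
set K := lip L (uemb b) + 1.
have K0 : 0 < K by rewrite ltr_wpDl// lip_ge0.
have d0 : 0 < e / 3 / K by rewrite divr_gt0.
apply: filterS (nbhsx_ballx phi _ d0) => psi /= pb.
rewrite rnormE ltcR.
have le1 (chi : state A) : rnorm (chi a - chi b) < e / 3.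
  by rewrite -linearB (le_lt_trans (state_le _ _)).
rewrite (le_lt_trans (rnorm_dist (phi b) _ _))//.
have -> : e = e / 3 + (e / 3 + e / 3) by field.
rewrite ltrD// (le_lt_trans (rnorm_dist (psi b) _ _))//.
rewrite ler_ltD// ?(rnormB (psi b))//.
rewrite (le_trans (mk_eval_le sb Lb pb))// -/K.
by rewrite mulrC divfK// gt_eqF.
Qed.

(** Linearity reduces this to the real and imaginary parts s and t of a. *)
Lemma eval_continuous a :
  continuous (fun psi : mk_state L => (psi : state A) a : R[i]^o).
Proof.
pose s := (2^-1)%:C *: (a + cstar a).
pose t := (2^-1)%:C *: ((- 'i) *: (a - cstar a)).
have ss : sa s.
  by rewrite /sa /s /= cstarZ cstarD cstarK conj_real addrC.
have st : sa t.
  rewrite /sa /t /= !cstarZ cstarD cstarN cstarK conj_real rmorphN /= conjCi opprK.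
  by rewrite -opprB scalerN scaleNr.
have aE : a = s + 'i *: t.
  have iNi : 'i * (- 'i) = 1 :> R[i] by rewrite mulrN -expr2 sqrCi opprK.
  have -> : 'i *: t = (2^-1)%:C *: (a - cstar a).
    by rewrite /t !scalerA mulrAC iNi mul1r.
  have half2 : (2^-1)%:C * 2%:R = 1 :> R[i].
    by rewrite -(rmorph_nat (@real_complex R)) -rmorphM mulVf ?pnatr_eq0.
  rewrite /s -scalerDr addrACA subrr addr0 -mulr2n -[a *+ 2]scaler_nat.
  by rewrite scalerA half2 scale1r.
have -> : (fun psi : mk_state L => (psi : state A) a : R[i]^o) =
    (fun psi : mk_state L => ((psi : state A) s : R[i]^o) + 'i *: ((psi : state A) t : R[i]^o)).
  by apply/funext => psi; rewrite {1}aE linearD; congr (_ + _); rewrite linearZ.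
move=> phi; have phi_filter := @nbhs_filter (mk_state L) phi.
apply: cvgD; first exact: eval_sa_continuous.
by apply: cvgZl_tmp; exact: eval_sa_continuous.
Qed.

End MK.
End CStar.

Theorem proposition2p10 (R : realType) (A : cstarAlgType R)
    (L : lipschitz_seminorm A) (U : set (state A)) :
  weak_star_open A U -> mk_open L U.
Proof.
have idc : continuous (id : mk_state L -> weak_star_state A).
  apply: continuous_comp_initial => phi.
  have phi_filter := @nbhs_filter (mk_state L) phi.
  apply/(@pointwise_cvgP A R[i]^o
    ((fun chi : mk_state L => (chi : state A) : A -> R[i]^o) @ phi)) => a.
  exact: (@eval_continuous R A L a phi).
by move/continuousP : idc; exact.
Qed.
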